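(* Let $n\ge 1$, let $b>1$ be a real number and let $\log$ denote the logarithm in base $b$. Let $S\subseteq [n]^2$ be such that $\mathcal{M}_S\not\subseteq\Sigma$ (that is, $\mathcal{M}_S$ contains at least one non-singular matrix). Then $$\mathbf{E}\big(\log_+(\mathbf{c}^{\dagger}(A))\big)\leq 2\log n+2\log|S|+\log 4+\frac{1}{\ln b},$$ where $\mathbf{E}$ denotes expectation over $A\in\mathcal{R}_S$.
   Context: Notation: $[n]=\{1,\dots,n\}$; $\mathcal{M}$ is the set of $n\times n$ real matrices, $\Sigma\subset\mathcal{M}$ the subset of singular matrices. For $S\subseteq[n]^2$, $\mathcal{M}_S=\{A\in\mathcal{M}\mid a_{ij}=0 \text{ whenever } (i,j)\notin S\}$. $\mathcal{R}_S$ is the space of random $n\times n$ matrices obtained by setting $a_{ij}=0$ if $(i,j)\notin S$ and drawing all other entries independently from the standard Gaussian $N(0,1)$. $\log_+(x)=\log x$ if $x\ge 1$ and $\log_+(x)=0$ otherwise (with $\log_+(\infty)=\infty$). For $A\in\mathcal{M}$ and $\delta>0$, $\mathcal{B}(A,\delta)=\{A'\in\mathcal{M}\mid |a'_{ij}-a_{ij}|\le\delta|a_{ij}| \text{ for all } i,j\in[n]\}$ (so zero entries are not perturbed). Componentwise condition number for matrix inversion: for non-singular $A$ and $A'$ write $\Gamma=(\gamma_{k\ell})=A^{-1}$ and $\Gamma'=(\gamma'_{k\ell})=A'^{-1}$ (for $\delta$ small all matrices in $\mathcal{B}(A,\delta)$ are non-singular). For $k,\ell\in[n]$ with $\gamma_{k\ell}\neq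 0$ let $$\mathbf{c}^{\dagger}_{k\ell}(A)=\lim_{\delta\to 0}\ \sup_{A'\in\mathcal{B}(A,\delta)}\frac{|\gamma'_{k\ell}-\gamma_{k\ell}|}{\delta|\gamma_{k\ell}|};$$ for $k,\ell$ with $\gamma_{k\ell}=0$ let $\mathbf{c}^{\dagger}_{k\ell}(A)=0$ if $\lim_{\delta\to0}\sup_{A'\in\mathcal{B}(A,\delta)}\frac{|\gamma'_{k\ell}-\gamma_{k\ell}|}{\delta}=0$, and $\mathbf{c}^{\dagger}_{k\ell}(A)=\infty$ otherwise. Then $\mathbf{c}^{\dagger}(A)=\max_{k,\ell\in[n]}\mathbf{c}^{\dagger}_{k\ell}(A)\in[0,\infty]$. The value of $\mathbf{c}^\dagger$ on singular matrices, which form a null set under the hypothesis of the claim, is immaterial. *)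

(* Defs.v *)
From HB Require Import structures.
From mathcomp Require Import all_boot all_order all_algebra.
From mathcomp Require Import all_classical all_reals all_analysis.

Set Implicit Arguments.
Unset Strict Implicit.
Unset Printing Implicit Defensive.

Import Order.TTheory GRing.Theory Num.Theory.
Import numFieldNormedType.Exports.

Local Open Scope classical_set_scope.
Local Open Scope ring_scope.

Definition singular_mx (R : realType) (n : nat) : set 'M[R]_n :=
  [set A | A \notin unitmx].

Definition pattern_mx (R : realType) (n : nat) (S : {set 'I_n * 'I_n}) :
    set 'M[R]_n :=
  [set A | forall i j, (i, j) \notin S -> A i j = 0].

Definition cball (R : realType) (n : nat) (A : 'M[R]_n) (delta : R) :
    set 'M[R]_n :=
  [set A' | forall i j, `|A' i j - A i j| <= delta * `|A i j|].

(* The limits are taken as delta tends to 0 from the right.  [invmx] of a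
   singular matrix is a junk value, but when A is non-singular all of
   [cball A delta] is non-singular for small delta. *)
Definition cond_inv_entry (R : realType) (n : nat) (A : 'M[R]_n)
    (k l : 'I_n) : \bar R :=
  let g := invmx A k l in
  if g != 0 then
    lim (ereal_sup [set (`|invmx A' k l - g| / (delta * `|g|))%:E
                   | A' in cball A delta] @[delta --> 0^'+])
  else if `[< ereal_sup [set (`|invmx A' k l - g| / delta)%:E
                        | A' in cball A delta] @[delta --> 0^'+] --> 0%E >]
  then 0%E else +oo%E.

(* Singular matrices are given condition number +oo by convention.
   For 0 < n the neutral element -oo does not affect the maximum. *)
Definition cond_inv (R : realType) (n : nat) (A : 'M[R]_n) : \bar R :=
  if A \in unitmx then
    \big[maxe/-oo%E]_(k < n) \big[maxe/-oo%E]_(l < n) cond_inv_entry A k l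
  else +oo%E.

Definition logb (R : realType) (b x : R) : R := ln x / ln b.

Definition logb_plus (R : realType) (b : R) (x : \bar R) : \bar R :=
  match x with
  | r%:E => if 1 <= r then (logb b r)%:E else 0%E
  | +oo%E => +oo%E
  | -oo%E => 0%E
  end.

Definition mutually_independent (d : measure_display) (T : measurableType d)
    (R : realType) (P : probability T R) (I : finType) (D : {set I})
    (X : I -> {RV P >-> R}) : Prop :=
  forall (J : {set I}) (B : I -> set R), J \subset D ->
    (forall i, i \in J -> measurable (B i)) ->
    P (\bigcap_(i in [set` J]) X i @^-1` B i) =
      (\prod_(i in J) P (X i @^-1` B i))%E.

(* Only measurable sets are compared: the values of a measure are
   unconstrained elsewhere. *)
Definition standard_gaussian (d : measure_display) (T : measurableType d)
    (R : realType) (P : probability T R) (X : {RV P >-> R}) : Prop :=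
  forall B : set R, measurable B -> distribution P X B = normal_prob 0 1 B.

Definition sparse_mx (d : measure_display) (T : measurableType d)
    (R : realType) (P : probability T R) (n : nat) (S : {set 'I_n * 'I_n})
    (X : 'I_n * 'I_n -> {RV P >-> R}) (w : T) : 'M[R]_n :=
  \matrix_(i, j) if (i, j) \in S then X (i, j) w else 0.

(* Main.v *)
(* For non-singular A the condition number of the entry g_kl of the inverse is
   sum_ij |a_ij g_ki g_jl| / |g_kl|, by the resolvent identity. Let A0 be A with
   a_ij replaced by 0. Each summand is at most r(adj_kl) + r(det), where
   r(F) = |F(A) - F(A0)| / |F(A)|. Both adj_kl and det are affine in the Gaussian
   entry a = a_ij, which is independent of the other entries, so
   r(F) = |a| / |a - z| with z independent of a, and r(F) >= t has probability
   at most 1/t when t >= 2. With V the maximum of all these ratios, a union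
   bound gives P(V >= t) <= 2 n^2 |S| / t for t >= 2, hence
   E ln_+ V <= ln (2 n^2 |S|) + 1, while the condition number is at most
   2 |S| V unless det A, or some cofactor that is not identically 0 on the
   pattern, vanishes. This happens with probability 0: start from a matrix of
   the pattern at which the given polynomial is non-zero and replace its
   entries by Gaussian ones, one at a time. *)

Require Import Defs.
From HB Require Import structures.
From mathcomp Require Import all_boot all_order all_algebra.
From mathcomp Require Import all_classical all_reals all_analysis.
From mathcomp Require Import measurable_realfun ring lra.

Set Implicit Arguments.
Unset Strict Implicit.
Unset Printing Implicit Defensive.

Import Order.TTheory GRing.Theory Num.Theory.
Import numFieldNormedType.Exports.
Import HBNNSimple.

Local Open Scope classical_set_scope.
Local Open Scope ring_scope.

(** * Cofactors as functions of one entry *)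

Definition set_entry (R : realType) (n : nat) (A : 'M[R]_n) (p : 'I_n * 'I_n)
    (h : R) : 'M[R]_n :=
  \matrix_(i, j) if (i, j) == p then h else A i j.

(** Affinity is expressed by interpolating the values at 0 and 1, so that the coefficients need not
    be named. They do not depend on the entry of [A] at [p], which [set_entry] overwrites. *)
Definition entry_affine (R : realType) (n : nat) (F : 'M[R]_n -> R) : Prop :=
  forall A p h, F (set_entry A p h) =
    F (set_entry A p 0) + h * (F (set_entry A p 1) - F (set_entry A p 0)).

(** Since [f] is injective, the entry occurs in at most one row of the submatrix, and the
    determinant is linear in that row. The whole determinant and all minors are instances. *)
Lemma det_mxsub_affine (R : realType) (n m : nat) (f g : 'I_m -> 'I_n) :
  injective f -> entry_affine (fun A : 'M[R]_n => \det (mxsub f g A)).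
Proof.
move=> f_inj A [i j] h.
have [[i0 fi0]|nf] := pselect (exists i0, f i0 = i); last first.
  have E x : mxsub f g (set_entry A (i, j) x) = mxsub f g A.
    apply/matrixP => u v; rewrite !mxE; case: eqP => // -[fu _].
    by case: nf; exists u.
  by rewrite !E subrr mulr0 addr0.
have E x y : row' i0 (mxsub f g (set_entry A (i, j) x)) =
    row' i0 (mxsub f g (set_entry A (i, j) y)).
  apply/matrixP => u v; rewrite !mxE; case: eqP => // -[fu _].
  by move: fu; rewrite -fi0 => /f_inj/eqP; rewrite eq_sym (negbTE (neq_lift _ _)).
(* Row [i0] with entry [h] is [1 - h] times the row with entry 0 plus [h] times the row with entry
   1. *)
rewrite (@determinant_multilinear _ _ _ (mxsub f g (set_entry A (i, j) 0))
  (mxsub f g (set_entry A (i, j) 1)) i0 (1 - h) h) //; first by ring.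
apply/rowP => v; rewrite !mxE; case: ifP => _; ring.
Qed.

Lemma det_affine (R : realType) (n : nat) :
  entry_affine (fun A : 'M[R]_n => \det A).
Proof.
move=> A p h; have := @det_mxsub_affine R n n id id (@inj_id _) A p h.
by rewrite !mxsub_id.
Qed.

Lemma minorE (R : realType) (n : nat) (A : 'M[R]_n) (k l : 'I_n) :
  row' l (col' k A) = mxsub (lift l) (lift k) A.
Proof. by apply/matrixP => i j; rewrite !mxE. Qed.

Lemma adj_affine (R : realType) (n : nat) (k l : 'I_n) :
  entry_affine (fun A : 'M[R]_n => (\adj A) k l).
Proof.
move=> A p h; rewrite !mxE /cofactor !minorE.
rewrite (det_mxsub_affine _ (@lift_inj _ l) A p h); ring.
Qed.

(** The minor behind entry [(j, l)] of the adjugate omits column [j], and the changed entry with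
    it. *)
Lemma adj_set_entry_col (R : realType) (n : nat) (A : 'M[R]_n) (i j l : 'I_n)
    (h : R) :
  (\adj (set_entry A (i, j) h)) j l = (\adj A) j l.
Proof.
rewrite !mxE /cofactor !minorE; congr (_ * \det _).
apply/matrixP => u v; rewrite !mxE; case: eqP => // -[_ jv].
by move/eqP: jv; rewrite eq_sym (negbTE (neq_lift _ _)).
Qed.

Lemma invmx_adjE (R : realType) (n : nat) (A : 'M[R]_n) (k l : 'I_n) :
  A \in unitmx -> (\adj A) k l = \det A * invmx A k l.
Proof.
move=> uA; rewrite /invmx uA !mxE mulrA divff ?mul1r//.
by move: uA; rewrite unitmxE unitfE.
Qed.

(* Entry (k, l) of invmx A *m A *m \adj A0 = \adj A0, where A0 is A with its
   entry (i, j) set to 0, so that A *m \adj A0 = (\det A0)%:M plus a rank one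
   term. *)
Lemma invmx_rank_one (R : realType) (n : nat) (A : 'M[R]_n) (i j k l : 'I_n) :
  A \in unitmx ->
  A i j * invmx A k i * invmx A j l * \det A =
    (\adj (set_entry A (i, j) 0)) k l -
    invmx A k l * \det (set_entry A (i, j) 0).
Proof.
move=> uA; set A0 := set_entry A (i, j) 0.
have AE : A = A0 + A i j *: delta_mx i j.
  apply/matrixP => u v; rewrite !mxE xpair_eqE.
  by case: andP => [[/eqP -> /eqP ->]|_]; rewrite ?mulr1 ?mulr0 ?add0r ?addr0.
have RE : (invmx A *m (delta_mx i j *m \adj A0)) k l =
    invmx A k i * (\adj A0) j l.
  rewrite mxE (bigD1 i)//= big1 => [|u ui].
    rewrite addr0; congr (_ * _); rewrite mxE (bigD1 j)//= big1 => [|v vj].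
      by rewrite mxE !eqxx mul1r addr0.
    by rewrite mxE (negbTE vj) andbF mul0r.
  by rewrite mxE big1 ?mulr0// => v _; rewrite mxE (negbTE ui) mul0r.
have : invmx A *m (A *m \adj A0) = \adj A0 by rewrite mulKmx.
rewrite {2}AE mulmxDl mul_mx_adj mulmxDr -scalemxAl -scalemxAr mul_mx_scalar.
move=> /matrixP/(_ k l); rewrite mxE [X in X + _]mxE [X in _ + X]mxE RE => <-.
rewrite adj_set_entry_col (invmx_adjE _ _ uA); ring.
Qed.

(** This is r(F) of the overview. Division by 0 gives 0, so the ratio is 0 wherever [F A]
    vanishes. *)
Definition entry_ratio (R : realType) (n : nat) (F : 'M[R]_n -> R)
    (p : 'I_n * 'I_n) (A : 'M[R]_n) : R :=
  `|F A - F (set_entry A p 0)| / `|F A|.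

(** Divided by [\det A] and by the entry of the inverse, [invmx_rank_one] gives a difference of two
    quotients, F(A0) / F(A) for the cofactor and for the determinant. Each is 1 minus a signed
    ratio, and the ones cancel. *)
Lemma inv_entry_ratio (R : realType) (n : nat) (A : 'M[R]_n) (i j k l : 'I_n) :
  A \in unitmx -> invmx A k l != 0 ->
  `|A i j * invmx A k i * invmx A j l| / `|invmx A k l| <=
    entry_ratio (fun A : 'M[R]_n => (\adj A) k l) (i, j) A +
    entry_ratio (fun A : 'M[R]_n => \det A) (i, j) A.
Proof.
move=> uA g0; have := invmx_rank_one i j k l uA.
have d0 : \det A != 0 by move: uA; rewrite unitmxE unitfE.
rewrite /entry_ratio (invmx_adjE _ _ uA) -!normf_div.
set x := A i j * _ * _; set g := invmx A k l in g0 *; set d := \det A in d0 *.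
set a0 := \adj _ k l; set d0' := \det (set_entry _ _ _) => EQ.
have -> : x / g = - ((d * g - a0) / (d * g)) + (d - d0') / d.
  have -> : x = (a0 - g * d0') / d by rewrite -EQ mulfK.
  by field; rewrite g0 d0.
by rewrite (le_trans (ler_normD _ _))// normrN.
Qed.

(** * The condition number of an entry of the inverse *)

(** The entrywise l1 norm is submultiplicative, dominates every entry and is monotone in the
    absolute values of the entries, as suits componentwise perturbations. *)
Definition norm1 (R : realType) (m n : nat) (A : 'M[R]_(m, n)) : R :=
  \sum_i \sum_j `|A i j|.

Lemma norm1_ge0 (R : realType) (m n : nat) (A : 'M[R]_(m, n)) : 0 <= norm1 A.
Proof. by apply: sumr_ge0 => i _; apply: sumr_ge0. Qed.

Lemma ler_norm1 (R : realType) (m n : nat) (A B : 'M[R]_(m, n)) :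
  (forall i j, `|A i j| <= `|B i j|) -> norm1 A <= norm1 B.
Proof. by move=> AB; apply: ler_sum => i _; apply: ler_sum. Qed.

Lemma norm1D (R : realType) (m n : nat) (A B : 'M[R]_(m, n)) :
  norm1 (A + B) <= norm1 A + norm1 B.
Proof.
rewrite /norm1 -big_split; apply: ler_sum => i _; rewrite -big_split.
by apply: ler_sum => j _; rewrite mxE ler_normD.
Qed.

Lemma norm1N (R : realType) (m n : nat) (A : 'M[R]_(m, n)) :
  norm1 (- A) = norm1 A.
Proof.
by apply: eq_bigr => i _; apply: eq_bigr => j _; rewrite mxE normrN.
Qed.

Lemma norm1Z (R : realType) (m n : nat) (a : R) (A : 'M[R]_(m, n)) :
  norm1 (a *: A) = `|a| * norm1 A.
Proof.
rewrite /norm1 mulr_sumr; apply: eq_bigr => i _; rewrite mulr_sumr.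
by apply: eq_bigr => j _; rewrite mxE normrM.
Qed.

Lemma norm1_entry (R : realType) (m n : nat) (A : 'M[R]_(m, n)) i j :
  `|A i j| <= norm1 A.
Proof.
rewrite /norm1 (bigD1 i)//= (bigD1 j)//= -addrA lerDl addr_ge0//.
  by apply: sumr_ge0.
by apply: sumr_ge0 => u _; apply: sumr_ge0.
Qed.

Lemma norm1_eq0 (R : realType) (m n : nat) (A : 'M[R]_(m, n)) :
  norm1 A <= 0 -> A = 0.
Proof.
move=> A0; apply/matrixP => i j; rewrite mxE; apply/eqP.
by rewrite -normr_le0 (le_trans (norm1_entry A i j)).
Qed.

Lemma norm1M (R : realType) (m n p : nat) (A : 'M[R]_(m, n))
    (B : 'M[R]_(n, p)) : norm1 (A *m B) <= norm1 A * norm1 B.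
Proof.
rewrite /norm1 mulr_suml; apply: ler_sum => i _.
apply: (@le_trans _ _ (\sum_k \sum_j `|A i j| * `|B j k|)).
  apply: ler_sum => k _; rewrite mxE (le_trans (ler_norm_sum _ _ _))//.
  by apply: ler_sum => j _; rewrite normrM.
rewrite exchange_big /= mulr_suml; apply: ler_sum => j _.
rewrite -mulr_sumr ler_wpM2l//.
(* Applied to the column of row sums of [|B|], [norm1_entry] bounds one row sum by the whole
   norm. *)
have := @norm1_entry R n 1 (\col_j \sum_k `|B j k|) j ord0.
rewrite mxE ger0_norm ?sumr_ge0// => /le_trans; apply.
rewrite /norm1; apply: ler_sum => u _; rewrite big_ord1 mxE ger0_norm//.
by rewrite sumr_ge0.
Qed.

(** * Perturbation of the inverse over the componentwise ball *)

Lemma cball_norm1 (R : realType) (n : nat) (A A' : 'M[R]_n) (delta : R) :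
  0 <= delta -> cball A delta A' -> norm1 (A' - A) <= delta * norm1 A.
Proof.
move=> d0 AA'; rewrite -{1}(ger0_norm d0) -norm1Z; apply: ler_norm1 => i j.
by rewrite !mxE (le_trans (AA' i j))// normrM ger0_norm.
Qed.

(** The left kernel [K] of [A'] satisfies K = - K (A' - A) A^-1, hence has norm at most half its own
    norm. *)
Lemma cball_unitmx (R : realType) (n : nat) (A A' : 'M[R]_n) (delta : R) :
  A \in unitmx -> 0 <= delta -> delta * norm1 A * norm1 (invmx A) <= 2^-1 ->
  cball A delta A' -> A' \in unitmx.
Proof.
move=> uA d0 small /(cball_norm1 d0) AA'.
rewrite -row_free_unit -kermx_eq0; apply/eqP; set K := kermx A'.
have KA' : K *m A' = 0 by exact: mulmx_ker.
have EQ : K = - (K *m (A' - A) *m invmx A).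
  by rewrite mulmxBr KA' sub0r mulNmx mulmxK// opprK.
apply: norm1_eq0.
have : norm1 K <= norm1 K * (delta * norm1 A * norm1 (invmx A)).
  rewrite {1}EQ norm1N -mulmxA (le_trans (norm1M _ _))// ler_wpM2l ?norm1_ge0//.
  by rewrite (le_trans (norm1M _ _))// ler_wpM2r ?norm1_ge0.
have := norm1_ge0 K; nra.
Qed.

(** With G, G' the two inverses and E = A' - A, the remainder after the first-order term is exactly
    G E G' E G, which is quadratic in [delta] once G' is bounded. *)
Lemma invmx_cball (R : realType) (n : nat) (A A' : 'M[R]_n) (delta : R) :
  A \in unitmx -> 0 <= delta -> delta * norm1 A * norm1 (invmx A) <= 2^-1 ->
  cball A delta A' ->
  norm1 (invmx A' - invmx A + invmx A *m (A' - A) *m invmx A) <=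
    2 * norm1 (invmx A) ^+ 3 * norm1 A ^+ 2 * delta ^+ 2.
Proof.
move=> uA d0 small cA'; have uA' := cball_unitmx uA d0 small cA'.
have NE := cball_norm1 d0 cA'.
set G := invmx A in small *; set G' := invmx A'; set E := A' - A in NE *.
have G'E : G' - G = - (G *m E *m G').
  by rewrite mulmxBr mulmxBl mulmxK// mulVmx// mul1mx opprB.
have G'E2 : G' - G = - (G' *m E *m G).
  rewrite mulmxBr mulmxBl mulVmx// mul1mx -mulmxA mulmxV// mulmx1.
  by rewrite opprB.
(* The smallness hypothesis gives norm G' <= norm G + (norm G') / 2. *)
have NG' : norm1 G' <= 2 * norm1 G.
  have : norm1 G' <= norm1 G + norm1 G * (delta * norm1 A) * norm1 G'.
    rewrite -{1}(subrK G G') addrC (le_trans (norm1D _ _))// lerD2l G'E norm1N.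
    rewrite (le_trans (norm1M _ _))// ler_wpM2r ?norm1_ge0//.
    by rewrite (le_trans (norm1M _ _))// ler_wpM2l ?norm1_ge0.
  have := norm1_ge0 G'; have := norm1_ge0 G; move: small; nra.
have -> : G' - G + G *m E *m G = G *m E *m G' *m E *m G.
  by rewrite G'E addrC -mulmxBr -(opprB G' G) G'E2 opprK !mulmxA.
have GE0 : norm1 (G *m E) <= norm1 G * (delta * norm1 A).
  by rewrite (le_trans (norm1M _ _))// ler_wpM2l ?norm1_ge0.
have G'E0 : norm1 (G' *m E *m G) <= 2 * norm1 G * (delta * norm1 A) * norm1 G.
  rewrite (le_trans (norm1M _ _))// ler_wpM2r ?norm1_ge0//.
  rewrite (le_trans (norm1M _ _))// ler_pM ?norm1_ge0//.
rewrite -!mulmxA mulmxA (mulmxA G') (le_trans (norm1M _ _))//.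
rewrite (le_trans (ler_pM _ _ GE0 G'E0)) ?norm1_ge0//.
by rewrite le_eqVlt; apply/orP; left; apply/eqP; ring.
Qed.

Lemma mulmx3_entry (R : realType) (n : nat) (G E H : 'M[R]_n) (k l : 'I_n) :
  (G *m E *m H) k l = \sum_i \sum_j E i j * G k i * H j l.
Proof.
rewrite mxE exchange_big /=; apply: eq_bigr => j _; rewrite mxE mulr_suml.
by apply: eq_bigr => i _; rewrite mulrAC [E i j * _]mulrC mulrAC.
Qed.

(** For [0 <= delta], [delta] times this number is the largest first-order change of entry [(k, l)]
    of the inverse over [cball A delta]. *)
Definition inv_sensitivity (R : realType) (n : nat) (A : 'M[R]_n)
    (k l : 'I_n) : R :=
  \sum_i \sum_j `|A i j * invmx A k i * invmx A j l|.

Lemma near_small_perturbation (R : realType) (n : nat) (A : 'M[R]_n) :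
  \forall delta \near 0^'+,
    0 < delta /\ delta * norm1 A * norm1 (invmx A) <= 2^-1.
Proof.
have small0 : 0 < (2 * (norm1 A * norm1 (invmx A) + 1))^-1.
  by rewrite invr_gt0 mulr_gt0// ltr_wpDl// mulr_ge0// norm1_ge0.
near=> delta.
have dp : 0 < delta by [].
have : delta * (2 * (norm1 A * norm1 (invmx A) + 1)) <= 1.
  rewrite -ler_pdivlMr; last by rewrite -invr_gt0.
  by rewrite div1r ltW//; near: delta; exact: nbhs_right_lt.
by split => //; nra.
Unshelve. all: by end_near.
Qed.

(** The supremum differs from the claimed value by at most a multiple of [delta], by the quadratic
    remainder bound; the limit follows by squeezing. *)
Lemma cond_inv_entryE (R : realType) (n : nat) (A : 'M[R]_n) (k l : 'I_n) :
  A \in unitmx -> invmx A k l != 0 ->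
  cond_inv_entry A k l = (inv_sensitivity A k l / `|invmx A k l|)%:E.
Proof.
move=> uA g0; rewrite /cond_inv_entry g0.
set g := invmx A k l in g0 *; set c := inv_sensitivity A k l.
set K := 2 * norm1 (invmx A) ^+ 3 * norm1 A ^+ 2.
have gp : 0 < `|g| by rewrite normr_gt0.
set F := fun delta : R => ereal_sup _.
have bounds (delta : R) : 0 < delta ->
    delta * norm1 A * norm1 (invmx A) <= 2^-1 ->
    (((c - K * delta) / `|g|)%:E <= F delta <= ((c + K * delta) / `|g|)%:E)%E.
  move=> d0 small; have d0' := ltW d0.
  have dg : 0 < delta * `|g| by rewrite mulr_gt0.
  have first_order A' : cball A delta A' ->
      `|invmx A' k l - g + \sum_i \sum_j (A' - A) i j * invmx A k i * invmx A j l|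
        <= K * delta ^+ 2.
    move=> /(invmx_cball uA d0' small); apply: le_trans.
    by rewrite -mulmx3_entry; apply: le_trans (norm1_entry _ k l); rewrite !mxE.
  apply/andP; split.
    (* The signs make all terms of the first-order sum nonnegative, so this perturbation attains the
       maximal first-order change. *)
    pose A' : 'M[R]_n := \matrix_(i, j) (A i j +
      delta * Num.sg (A i j * invmx A k i * invmx A j l) * A i j).
    have cA' : cball A delta A'.
      move=> i j; rewrite mxE addrC addKr !normrM (ger0_norm d0').
      by rewrite ler_wpM2r// ler_piMr// normr_sg; case: eqP.
    apply: ereal_sup_ge; exists (`|invmx A' k l - g| / (delta * `|g|))%:E.
      by exists A'.
    have := first_order _ cA'.
    rewrite (_ : \sum_i _ = delta * c); last first.
      rewrite /c /inv_sensitivity mulr_sumr; apply: eq_bigr => i _.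
      rewrite mulr_sumr; apply: eq_bigr => j _.
      have -> : (A' - A) i j =
          delta * Num.sg (A i j * invmx A k i * invmx A j l) * A i j.
        by rewrite !mxE addrC addKr.
      by rewrite normrEsg; ring.
    set x := _ - g => Hx; rewrite lee_fin ler_pdivlMr//.
    have -> : (c - K * delta) / `|g| * (delta * `|g|) = (c - K * delta) * delta.
      by field; rewrite gt_eqF.
    have := ler_normB (x + delta * c) x; rewrite addrAC subrr add0r ger0_norm.
      by rewrite expr2 in Hx; lra.
    by rewrite mulr_ge0// sumr_ge0// => i _; rewrite sumr_ge0.
  apply: ub_ereal_sup => _ [A' cA' <-]; have := first_order _ cA'.
  set x := _ - g; set s := \sum_i _ => Hx.
  have Hs : `|s| <= delta * c.
    rewrite /s /c mulr_sumr (le_trans (ler_norm_sum _ _ _))//.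
    apply: ler_sum => i _; rewrite mulr_sumr (le_trans (ler_norm_sum _ _ _))//.
    apply: ler_sum => j _; rewrite !normrM !mulrA !ler_wpM2r//.
    by rewrite !mxE.
  rewrite lee_fin ler_pdivrMr//.
  have -> : (c + K * delta) / `|g| * (delta * `|g|) = (c + K * delta) * delta.
    by field; rewrite gt_eqF.
  have := ler_normB (x + s) s; rewrite addrK expr2 in Hx * => H.
  lra.
apply/cvg_lim => //.
(* Taking [a] to be [K] and [- K] covers both bounds. *)
have cvg_side (a : R) : ((c + a * delta) / `|g|)%:E @[delta --> 0^'+] -->
    (c / `|g|)%:E.
  apply/fine_cvgP; split; first exact: nearW.
  apply: cvgMl; rewrite -{2}[c]addr0; apply: cvgD; first exact: cvg_cst.
  rewrite -[X in _ --> X](mulr0 a); apply: cvgMr.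
  by apply: cvg_at_right_filter; exact: cvg_id.
have cvgN : ((c - K * delta) / `|g|)%:E @[delta --> 0^'+] --> (c / `|g|)%:E.
  by have := cvg_side (- K); under eq_fun do rewrite mulNr.
apply: (squeeze_cvge _ cvgN (cvg_side K)).
by apply: filterS (near_small_perturbation A) => delta [d0 /(bounds _ d0)].
Qed.

Lemma cball_pattern (R : realType) (n : nat) (S : {set 'I_n * 'I_n})
    (A A' : 'M[R]_n) (delta : R) :
  pattern_mx S A -> cball A delta A' -> pattern_mx S A'.
Proof.
move=> SA cA' i j ijS; apply/eqP; rewrite -normr_le0.
by have := cA' i j; rewrite SA// subr0 normr0 mulr0.
Qed.

(** For small [delta] the ball consists of invertible matrices of the same pattern, so the entry of
    the inverse is 0 throughout it. *)
Lemma cond_inv_entry0 (R : realType) (n : nat) (S : {set 'I_n * 'I_n})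
    (A : 'M[R]_n) (k l : 'I_n) :
  A \in unitmx -> pattern_mx S A ->
  (forall B : 'M[R]_n, pattern_mx S B -> (\adj B) k l = 0) ->
  cond_inv_entry A k l = 0%E.
Proof.
move=> uA SA adj0.
have inv0 (B : 'M[R]_n) : B \in unitmx -> pattern_mx S B -> invmx B k l = 0.
  move=> uB SB; have := invmx_adjE k l uB; rewrite adj0// => /esym/eqP.
  rewrite mulf_eq0 => /orP[|/eqP//].
  by move: uB; rewrite unitmxE unitfE => /negbTE ->.
rewrite /cond_inv_entry inv0// eqxx/=; case: asboolP => //; case.
apply: cvg_near_cst.
apply: filterS (near_small_perturbation A) => delta [dp small].
have -> : [set (`|invmx A' k l - 0| / delta)%:E | A' in cball A delta] =
    [set 0%E].
  apply/seteqP; split=> [_ [A' cA' <-]|_ ->] /=.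
    rewrite inv0 ?subr0 ?normr0 ?mul0r//; last exact: cball_pattern cA'.
    exact: cball_unitmx uA (ltW dp) small cA'.
  exists A; last by rewrite inv0// subr0 normr0 mul0r.
  by move=> i j; rewrite subrr normr0 mulr_ge0// (ltW dp).
by rewrite ereal_sup1.
Qed.

(** The alternative on the cofactors excludes an accidental zero of the inverse, where the condition
    number can be infinite. Elsewhere each position of [S] contributes two ratios, whence the factor
    [2 * #|S|]. *)
Lemma cond_inv_le (R : realType) (n : nat) (S : {set 'I_n * 'I_n})
    (A : 'M[R]_n) (v : R) :
  A \in unitmx -> pattern_mx S A -> 0 <= v ->
  (forall k l, (\adj A) k l != 0 \/
    forall B : 'M[R]_n, pattern_mx S B -> (\adj B) k l = 0) ->
  (forall p, p \in S -> entry_ratio (fun A : 'M[R]_n => \det A) p A <= v) ->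
  (forall p k l, p \in S ->
    entry_ratio (fun A : 'M[R]_n => (\adj A) k l) p A <= v) ->
  (cond_inv A <= (2 * #|S|%:R * v)%:E)%E.
Proof.
move=> uA SA v0 adjA detv adjv; rewrite /cond_inv uA.
apply: bigmax_le; first exact: leNye.
move=> k _; apply: bigmax_le; first exact: leNye.
move=> l _; case: (adjA k l) => [akl|]; last first.
  by move=> /(cond_inv_entry0 uA SA) ->; rewrite lee_fin !mulr_ge0.
have g0 : invmx A k l != 0.
  by apply: contraNneq akl => g0; rewrite (invmx_adjE _ _ uA) g0 mulr0.
rewrite cond_inv_entryE// lee_fin /inv_sensitivity pair_big /=.
rewrite mulr_suml (bigID (mem S))/= [X in _ + X]big1 ?addr0; last first.
  by move=> [i j] ijS; rewrite SA// !mul0r normr0 mul0r.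
apply: (@le_trans _ _ (\sum_(p in S) 2 * v)); last first.
  by rewrite sumr_const -[X in X <= _]mulr_natr; lra.
apply: ler_sum => -[i j] ijS; apply: le_trans (inv_entry_ratio i j uA g0) _.
by have := detv _ ijS; have := adjv _ k l ijS; lra.
Qed.

(** * Independence and the standard Gaussian law *)

(** A pi-system containing the whole space; it generates the sigma-algebra of the variables indexed
    by [D]. *)
Definition cylinders (R : realType) (d : measure_display)
    (T : measurableType d) (P : probability T R) (I : finType) (D : {set I})
    (X : I -> {RV P >-> R}) : set (set T) :=
  [set E | exists2 B : I -> set R, forall q, measurable (B q) &
     E = \bigcap_(q in [set` D]) X q @^-1` B q].

Lemma measurable_preimage_RV (R : realType) (d : measure_display)
    (T : measurableType d) (P : probability T R) (X : {RV P >-> R})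
    (A : set R) : measurable A -> measurable (X @^-1` A).
Proof.
by move=> mA; rewrite -[X in measurable X]setTI; exact: measurable_funPT.
Qed.

Lemma measurable_cylinders (R : realType) (d : measure_display)
    (T : measurableType d) (P : probability T R) (I : finType) (D : {set I})
    (X : I -> {RV P >-> R}) : cylinders D X `<=` measurable.
Proof.
move=> _ [B mB ->]; apply: fin_bigcap_measurable => // q _.
exact: measurable_preimage_RV.
Qed.

(** As functions of [E], both sides are finite measures. They agree on the pi-system of cylinders,
    hence on the sigma-algebra it generates. *)
Lemma independent_cylinders (R : realType) (d : measure_display)
    (T : measurableType d) (P : probability T R) (I : finType) (S : {set I})
    (X : I -> {RV P >-> R}) (p : I) (A : set R) (E : set T) :
  mutually_independent S X -> p \in S -> measurable A ->
  <<s cylinders (S :\ p) X >> E ->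
  P (X p @^-1` A `&` E) = (P (X p @^-1` A) * P E)%E.
Proof.
move=> Xindep pS mA sE.
have mXA := measurable_preimage_RV (X p) mA.
have finA : P (X p @^-1` A) \is a fin_num by exact: fin_num_measure.
pose a : {nonneg R} := NngNum (fine_ge0 (measure_ge0 P (X p @^-1` A))).
have aE : (a%:num)%:E = P (X p @^-1` A) by exact: fineK.
have mE F : mscale a P F = (P (X p @^-1` A) * P F)%E by rewrite /mscale aE.
suff : mrestr P mXA E = mscale a P E.
  by rewrite mE /mrestr setIC.
have cylT : cylinders (S :\ p) X [set: T].
  exists (fun=> setT) => //; apply/seteqP; split => //.
apply: (@g_sigma_algebra_measure_unique _ _ _ (cylinders (S :\ p) X)
  (@measurable_cylinders _ _ _ _ _ _ _) (fun=> setT)) sE => //.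
- by apply/seteqP; split => // x _; exists 0%N.
- move=> _ _ [B mB ->] [C mC ->]; exists (fun q => B q `&` C q).
    by move=> q; exact: measurableI.
  by rewrite -bigcapI; apply: eq_bigcapr => q _; rewrite preimage_setI.
- move=> _ [B mB ->]; rewrite [RHS]mE /= /mrestr.
  rewrite Xindep//; last exact: subD1set.
  (* Inserting [A] at coordinate [p] turns the intersection into a cylinder over all of [S], to
     which independence applies. *)
  pose C q := if q == p then A else B q.
  transitivity (P (\bigcap_(q in [set` S]) X q @^-1` C q)).
    congr (P _); apply/seteqP; split => w /=.
      move=> [HB HA] q qS; rewrite /C; case: eqP => [->//|/eqP qp].
      by apply: HB; rewrite /= !inE qp.
    move=> HC; split; last by have := HC p pS; rewrite /C eqxx.
    move=> q /=; rewrite !inE => /andP[qp qS]; have := HC q qS.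
    by rewrite /C (negbTE qp).
  rewrite Xindep//; last by move=> q _; rewrite /C; case: ifP.
  rewrite (big_setD1 p)//= /C eqxx; congr (_ * _)%E.
  by apply: eq_bigr => q; rewrite !inE => /andP[/negbTE -> _].
- by move=> k; rewrite /= /mrestr setTI -ge0_fin_numE.
Qed.

(** [H] is a function of the variables other than [X p], so the law of the pair is a product
    measure; the bound on the sections is then integrated over the law of [H]. *)
Lemma independent_product (R : realType) (d : measure_display)
    (T : measurableType d) (P : probability T R) (I : finType) (S : {set I})
    (X : I -> {RV P >-> R}) (p : I) (H : T -> R) (E : set (R * R)) (c : R) :
  mutually_independent S X -> p \in S -> standard_gaussian (X p) ->
  measurable_fun setT
    (H : g_sigma_algebraType (cylinders (S :\ p) X) -> R) ->
  measurable E ->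
  (forall y, (normal_prob 0 1 [set a | E (y, a)] <= c%:E)%E) ->
  (P [set w | E (H w, X p w)] <= c%:E)%E.
Proof.
move=> Xindep pS Xgauss mH mE Ec.
have sH (B : set R) : measurable B -> <<s cylinders (S :\ p) X >> (H @^-1` B).
  by move=> mB; have := mH measurableT B mB; rewrite setTI.
have mHT : measurable_fun setT H.
  move=> _ B mB; rewrite setTI.
  apply: (smallest_sub (@sigma_algebra_measurable _ T)
    (@measurable_cylinders _ _ _ _ _ _ _)).
  exact: sH.
have mHX : measurable_fun setT (fun w => (H w, X p w)).
  exact: measurable_fun_pair.
pose HM : {mfun T >-> R} := HB.pack H (isMeasurableFun.Build _ _ _ _ _ mHT).
pose HXM : {mfun T >-> (R * R)%type} :=
  HB.pack (fun w => (H w, X p w)) (isMeasurableFun.Build _ _ _ _ _ mHX).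
have -> : P [set w | E (H w, X p w)] = distribution P HXM E by [].
have <- := @product_measure_unique _ _ _ _ _ (distribution P HM)
  (distribution P (X p)) (distribution P HXM) _ _ mE; last first.
  move=> A B mA mB.
  rewrite /distribution /pushforward /= muleC -(independent_cylinders Xindep)//.
    by rewrite setIC.
  exact: sH.
rewrite /product_measure1.
have le_c y : (distribution P (X p) (xsection E y) <= c%:E)%E.
  rewrite Xgauss; last exact: measurable_xsection.
  by rewrite (_ : xsection E y = [set a | E (y, a)])// xsectionE.
apply: (@le_trans _ _ (\int[distribution P HM]_x c%:E)%E).
  by apply: ge0_le_integral => //=; exact: measurable_fun_xsection.
by rewrite integral_cst//= /distribution /pushforward preimage_setT
  probability_setT mule1.
Qed.

(** * Comparison events and Gaussian estimates *)

Lemma measurable_le_set (R : realType) (d : measure_display)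
    (T : measurableType d) (f g : T -> R) :
  measurable_fun setT f -> measurable_fun setT g ->
  measurable [set w | f w <= g w].
Proof.
by move=> mf mg; rewrite -[X in measurable X]setTI; exact: measurable_fun_le.
Qed.

Lemma measurable_eq_set (R : realType) (d : measure_display)
    (T : measurableType d) (f g : T -> R) :
  measurable_fun setT f -> measurable_fun setT g ->
  measurable [set w | f w = g w].
Proof.
move=> mf mg; have -> : [set w | f w = g w] =
    [set w | f w <= g w] `&` [set w | g w <= f w].
  by apply/seteqP; split => w /= => [->|[fg gf]]; [|apply/le_anti/andP].
by apply: measurableI; exact: measurable_le_set.
Qed.

(** A bound of order 1/|x| is scale invariant: an interval whose length is proportional to its
    distance from 0 gets a probability bound free of that distance. *)
Lemma normal_pdf_le (R : realType) (x : R) :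
  x != 0 -> normal_pdf 0 1 x <= (3 * `|x|)^-1.
Proof.
move=> x0; have xp : 0 < `|x| by rewrite normr_gt0.
rewrite normal_pdfE ?oner_eq0// /normal_peak /normal_fun subr0 expr1n mul1r.
have peak : (Num.sqrt (pi *+ 2))^-1 <= 2^-1 :> R.
  rewrite lef_pV2 ?posrE//; last first.
    by rewrite sqrtr_gt0 pmulrn_lgt0// pi_gt0.
  have -> : 2 = Num.sqrt (2 ^+ 2) :> R by rewrite sqrtr_sqr ger0_norm.
  by rewrite ler_sqrt; have := pi_ge2 R; rewrite ?expr2; lra.
have : expR (- x ^+ 2 / (1 *+ 2)) <= (3 / 2 * `|x|)^-1.
  rewrite mulNr expRN lef_pV2 ?posrE ?expR_gt0 ?mulr_gt0//.
  (* The two exponential factors are bounded below by 1 + y <= exp y: the first by 3/2, the second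
     by (x^2 + 1) / 2 >= |x|. *)
  have -> : x ^+ 2 / (1 *+ 2) = 2^-1 + (x ^+ 2 - 1) / 2 by field.
  rewrite expRD; apply: ler_pM => //.
    by apply: le_trans (expR_ge1Dx _); lra.
  apply: le_trans (expR_ge1Dx _); rewrite -(real_normK (num_real x)).
  by have := sqr_ge0 (`|x| - 1); rewrite !expr2; lra.
move=> fun_le; apply: le_trans (ler_pM _ _ peak fun_le) _ => //.
rewrite -invfM le_eqVlt; apply/orP; left; apply/eqP; congr (_^-1).
by field.
Qed.

Lemma normal_prob_le_itv (R : realType) (B : set R) (p q u : R) :
  measurable B -> B `<=` `[p, q] -> p <= q -> 0 < u ->
  (forall x, B x -> u <= `|x|) ->
  (normal_prob 0 1 B <= ((q - p) / (3 * u))%:E)%E.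
Proof.
move=> mB Bpq pq u0 Bu.
apply: (@le_trans _ _ (\int[lebesgue_measure]_(x in B) ((3 * u)^-1)%:E)%E).
  apply: ge0_le_integral => //=.
  - by move=> x _; rewrite lee_fin normal_pdf_ge0.
  - apply/measurable_EFinP; apply: measurable_funTS.
    exact: measurable_normal_pdf.
  - move=> x Bx; have ux := Bu x Bx.
    have x0 : 0 < `|x| by exact: lt_le_trans ux.
    rewrite lee_fin (le_trans (normal_pdf_le _)) -?normr_gt0//.
    by rewrite lef_pV2 ?posrE ?mulr_gt0// ler_pM2l.
rewrite integral_cst// [X in (_ <= X)%E]EFinM muleC lee_wpmul2r//.
  by rewrite lee_fin invr_ge0 mulr_ge0// ltW.
have : (lebesgue_measure B <= lebesgue_measure `[p, q]%classic)%E.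
  by apply: le_measure => //; rewrite inE//; exact: measurable_itv.
move=> /le_trans; apply; rewrite lebesgue_measure_itv /= lte_fin.
by case: ltgtP pq => // -> _; rewrite subrr.
Qed.

Lemma normal_prob_set1 (R : realType) (z : R) :
  normal_prob 0 1 [set z] = 0%E.
Proof.
apply: null_set_integral => //; last exact: lebesgue_measure_set1.
by apply/measurable_EFinP; apply: measurable_funTS; exact: measurable_normal_pdf.
Qed.

(* The event says that [a] lies in an interval around [z] whose endpoints are
   z t / (t + 1) and z t / (t - 1); it is cut at [z] because the density bound
   [(3 |a|)^-1] taken at the endpoint nearest to 0 loses too much on the whole
   interval. *)
Lemma normal_prob_ratio (R : realType) (z t : R) : 2 <= t ->
  (normal_prob 0 1 [set a : R | (t * `|a - z| <= `|a|)%R] <= (t^-1)%:E)%E.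
Proof.
move=> t2; set B := [set a | _].
have mB : measurable B.
  apply: measurable_le_set => //.
  apply: measurable_funM => //; apply: measurableT_comp => //.
  by apply: measurable_funB.
have t0 : 0 < t by lra.
have [z0|z0] := eqVneq z 0.
  rewrite (_ : B = [set 0]) ?normal_prob_set1 ?lee_fin ?invr_ge0 ?ltW//.
  apply/seteqP; split => [a|_ ->]; rewrite /B /= z0 ?subr0 ?normr0 ?mulr0//.
  by move=> H; apply/eqP; rewrite -normr_le0; have := normr_ge0 a; nra.
have zp : 0 < `|z| by rewrite normr_gt0.
have Bt a : B a -> t * (a - z) <= `|a| /\ t * (z - a) <= `|a|.
  move=> Ba; split; apply: le_trans Ba; rewrite ler_pM2l// ?ler_norm//.
  by rewrite distrC ler_norm.
have mS : measurable [set a : R | `|a| <= `|z|].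
  by apply: measurable_le_set => //; exact: measurable_normr.
pose B1 := B `&` [set a | `|a| <= `|z|].
pose B2 := B `&` ~` [set a | `|a| <= `|z|].
have mB1 : measurable B1 by exact: measurableI.
have mB2 : measurable B2 by apply: measurableI => //; exact: measurableC.
have P1 : (normal_prob 0 1 B1 <= ((3 * t)^-1)%:E)%E.
  (* This part lies between r t and z = r (t + 1): length |r|, at distance at least |r| t from 0. *)
  pose r := z / (t + 1).
  have zr : z = r * (t + 1) by rewrite /r divfK// gt_eqF//; lra.
  have -> : (3 * t)^-1 = `|r| / (3 * (`|r| * t)).
    field; rewrite normr_eq0 gt_eqF//= mulf_eq0 !negb_or z0/= invr_eq0.
    by rewrite gt_eqF//; lra.
  case: (ltP 0 z) => [z1|z1].
    have r0 : 0 < r by rewrite /r divr_gt0//; lra.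
    rewrite (gtr0_norm r0) -{1}[r](_ : r * (t + 1) - r * t = r); last by ring.
    apply: normal_prob_le_itv => //; first 1 last.
    - by nra.
    - by rewrite mulr_gt0.
    - move=> a [/Bt[H1 H2] _]; case: (ger0P a) H1 H2 => a0; nra.
    - move=> a [/Bt[H1 H2]] /=; rewrite (gtr0_norm z1) in_itv/=.
      by case: (ger0P a) H1 H2 => a0 H1 H2 H3; apply/andP; split; nra.
  have {}z1 : z < 0 by rewrite lt_neqAle z0.
  have r0 : r < 0 by rewrite /r pmulr_llt0// invr_gt0; lra.
  rewrite (ltr0_norm r0) -{1}[- r](_ : r * t - r * (t + 1) = - r); last by ring.
  apply: normal_prob_le_itv => //; first 1 last.
  - by nra.
  - by rewrite mulr_gt0// oppr_gt0.
  - move=> a [/Bt[H1 H2] _]; case: (ger0P a) H1 H2 => a0; nra.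
  - move=> a [/Bt[H1 H2]] /=; rewrite (ltr0_norm z1) in_itv/=.
    by case: (ger0P a) H1 H2 => a0 H1 H2 H3; apply/andP; split; nra.
have P2 : (normal_prob 0 1 B2 <= ((3 * (t - 1))^-1)%:E)%E.
  (* This part lies between z = r (t - 1) and r t: length |r|, at distance at least |r| (t - 1) from
     0. *)
  pose r := z / (t - 1).
  have zr : z = r * (t - 1) by rewrite /r divfK// gt_eqF//; lra.
  have t1 : 0 < t - 1 by lra.
  have -> : (3 * (t - 1))^-1 = `|r| / (3 * (`|r| * (t - 1))).
    field; rewrite normr_eq0 gt_eqF//= mulf_eq0 !negb_or z0/= invr_eq0.
    by rewrite gt_eqF//; lra.
  case: (ltP 0 z) => [z1|z1].
    have r0 : 0 < r by rewrite /r divr_gt0.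
    rewrite (gtr0_norm r0) -{1}[r](_ : r * t - r * (t - 1) = r); last by ring.
    apply: normal_prob_le_itv => //; first 1 last.
    - by nra.
    - by rewrite mulr_gt0.
    - move=> a [/Bt[H1 H2] /= /negP]; rewrite -ltNge (gtr0_norm z1); lra.
    - move=> a [/Bt[H1 H2]] /= /negP; rewrite -ltNge (gtr0_norm z1) in_itv/=.
      by case: (ger0P a) H1 H2 => a0 H1 H2 H3; apply/andP; split; nra.
  have {}z1 : z < 0 by rewrite lt_neqAle z0.
  have r0 : r < 0 by rewrite /r pmulr_llt0// invr_gt0.
  rewrite (ltr0_norm r0) -{1}[- r](_ : r * (t - 1) - r * t = - r); last by ring.
  apply: normal_prob_le_itv => //; first 1 last.
  - by nra.
  - by rewrite mulr_gt0// oppr_gt0.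
  - move=> a [/Bt[H1 H2] /= /negP]; rewrite -ltNge (ltr0_norm z1); lra.
  - move=> a [/Bt[H1 H2]] /= /negP; rewrite -ltNge (ltr0_norm z1) in_itv/=.
    by case: (ger0P a) H1 H2 => a0 H1 H2 H3; apply/andP; split; nra.
have -> : B = B1 `|` B2 by rewrite -setIUr setUCr setIT.
apply: le_trans (le_trans (_ : _ <= normal_prob 0 1 B1 + normal_prob 0 1 B2)%E
  (leeD P1 P2)) _; first exact: (@measureU2 _ _ _ (normal_prob 0 1)).
rewrite -EFinD lee_fin !invfM.
(* Here [2 <= t] enters; the two parts then add up to at most 1/(3t) + 2/(3t) = 1/t. *)
have : (t - 1)^-1 <= 2 / t.
  by rewrite ler_pdivlMr// ler_pdivrMl; lra.
lra.
Qed.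

(** * Random matrices with a given pattern *)

Lemma measurable_inv (R : realType) : measurable_fun [set: R] (@GRing.inv R).
Proof.
rewrite -(setUCl [set 0]); apply/measurable_funU => //.
  by apply: measurableC; exact: measurable_set1.
split; last exact: measurable_fun_set1.
apply: open_continuous_measurable_fun.
  by apply: closed_openC; exact: closed_eq.
by move=> x; rewrite inE => /eqP x0; exact: inv_continuous.
Qed.

(** Quantifying over all source spaces lets one fact serve both [T] and [T] with the sigma-algebra
    generated by cylinders. *)
Definition entry_measurable (R : realType) (n : nat) (F : 'M[R]_n -> R) : Prop :=
  forall (d : measure_display) (T : measurableType d) (M : T -> 'M[R]_n),
    (forall i j, measurable_fun [set: T] (fun w => M w i j)) ->
    measurable_fun [set: T] (fun w => F (M w)).

Lemma det_measurable (R : realType) (n : nat) :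
  entry_measurable (fun A : 'M[R]_n => \det A).
Proof.
move=> d T M mM; apply: measurable_sum => s; apply: measurable_funM => //.
by apply: measurable_prod => i _; exact: mM.
Qed.

Lemma adj_measurable (R : realType) (n : nat) (k l : 'I_n) :
  entry_measurable (fun A : 'M[R]_n => (\adj A) k l).
Proof.
move=> d T M mM; under eq_fun do rewrite mxE.
apply: measurable_funM => //.
apply: (@det_measurable R n.-1 d T (fun w => row' l (col' k (M w)))) => i j.
by under eq_fun do rewrite !mxE; exact: mM.
Qed.

(** Only the entries other than [p] have to be measurable, which gives measurability with respect to
    the sigma-algebra of those entries. *)
Lemma set_entry_measurable (R : realType) (n : nat) (F : 'M[R]_n -> R)
    (d : measure_display) (T : measurableType d) (M : T -> 'M[R]_n)
    (p : 'I_n * 'I_n) (h : R) :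
  entry_measurable F ->
  (forall i j, (i, j) != p -> measurable_fun [set: T] (fun w => M w i j)) ->
  measurable_fun [set: T] (fun w => F (set_entry (M w) p h)).
Proof.
move=> mF mM; apply: mF => i j; under eq_fun do rewrite mxE.
case: eqVneq => [_|ijp]; first exact: measurable_cst.
exact: (mM _ _ ijp).
Qed.

Lemma set_entry_id (R : realType) (n : nat) (A : 'M[R]_n) (p : 'I_n * 'I_n) :
  set_entry A p (A p.1 p.2) = A.
Proof.
by apply/matrixP => i j; rewrite mxE; case: eqP => // <-.
Qed.

Definition affine_slope (R : realType) (n : nat) (F : 'M[R]_n -> R)
    (p : 'I_n * 'I_n) (A : 'M[R]_n) : R :=
  F (set_entry A p 1) - F (set_entry A p 0).

(** The z of the overview, a function of the entries other than [p]. It is 0 by convention when the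
    slope vanishes. *)
Definition affine_root (R : realType) (n : nat) (F : 'M[R]_n -> R)
    (p : 'I_n * 'I_n) (A : 'M[R]_n) : R :=
  - F (set_entry A p 0) / affine_slope F p A.

Lemma affine_rootE (R : realType) (n : nat) (F : 'M[R]_n -> R)
    (p : 'I_n * 'I_n) (A : 'M[R]_n) (h : R) :
  entry_affine F -> affine_slope F p A != 0 ->
  F (set_entry A p h) = affine_slope F p A * (h - affine_root F p A).
Proof.
by move=> affF C0; rewrite affF -/(affine_slope F p A) /affine_root; field.
Qed.

Lemma affine_root_measurable (R : realType) (n : nat) (F : 'M[R]_n -> R)
    (d : measure_display) (T : measurableType d) (M : T -> 'M[R]_n)
    (p : 'I_n * 'I_n) :
  entry_measurable F ->
  (forall i j, (i, j) != p -> measurable_fun [set: T] (fun w => M w i j)) ->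
  measurable_fun [set: T] (fun w => affine_root F p (M w)).
Proof.
move=> mF mM; apply: measurable_funM.
  by apply: measurableT_comp => //; exact: set_entry_measurable.
apply: measurableT_comp; first exact: measurable_inv.
by apply: measurable_funB; exact: set_entry_measurable.
Qed.

(** For non-zero slope and away from the root, the slope cancels and the ratio is |a| / |a - z|. *)
Lemma entry_ratio_ge (R : realType) (n : nat) (F : 'M[R]_n -> R)
    (p : 'I_n * 'I_n) (A : 'M[R]_n) (t : R) :
  entry_affine F -> 0 < t -> t <= entry_ratio F p A ->
  t * `|A p.1 p.2 - affine_root F p A| <= `|A p.1 p.2|.
Proof.
move=> affF t0; rewrite /entry_ratio -{1 3}(set_entry_id A p).
set x := A p.1 p.2; have [C0|C0] := eqVneq (affine_slope F p A) 0.
  rewrite affF -/(affine_slope F p A) C0 mulr0 addr0 subrr normr0 mul0r.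
  by rewrite leNgt t0.
have -> : F (set_entry A p x) - F (set_entry A p 0) = affine_slope F p A * x.
  by rewrite !affine_rootE//; ring.
rewrite affine_rootE// !normrM -mulf_div divff ?normr_eq0// mul1r.
(* At the root [F] vanishes, and the ratio is 0 by convention, hence below [t]. *)
have [->|xr] := eqVneq x (affine_root F p A).
  by rewrite subrr normr0 invr0 mulr0 leNgt t0.
by rewrite ler_pdivlMr// normr_gt0 subr_eq0.
Qed.

Lemma entry_ratio_measurable (R : realType) (n : nat) (F : 'M[R]_n -> R)
    (d : measure_display) (T : measurableType d) (M : T -> 'M[R]_n)
    (p : 'I_n * 'I_n) :
  entry_measurable F ->
  (forall i j, measurable_fun [set: T] (fun w => M w i j)) ->
  measurable_fun [set: T] (fun w => entry_ratio F p (M w)).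
Proof.
move=> mF mM; apply: measurable_funM.
  apply: measurableT_comp => //; apply: measurable_funB; first exact: mF.
  by apply: set_entry_measurable => // i j _; exact: mM.
apply: measurableT_comp; first exact: measurable_inv.
by apply: measurableT_comp => //; exact: mF.
Qed.

(** * Tail bounds and null events for the random matrix *)

Lemma measurable_cylinders_RV (R : realType) (d : measure_display)
    (T : measurableType d) (P : probability T R) (I : finType) (D : {set I})
    (X : I -> {RV P >-> R}) (q : I) : q \in D ->
  measurable_fun setT (X q : g_sigma_algebraType (cylinders D X) -> R).
Proof.
move=> qD _ B mB; rewrite setTI; apply: sub_sigma_algebra.
exists (fun q' => if q' == q then B else setT).
  by move=> q'; case: ifP.
apply/seteqP; split => [w Bw q' _|w /(_ q qD)]; last by rewrite /= eqxx.
by rewrite /=; case: eqP => [->|].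
Qed.

(* Interpolates entrywise between a fixed matrix x and the random matrix. *)
Definition mixed_mx (R : realType) (n : nat) (d : measure_display)
    (T : measurableType d) (P : probability T R) (J : {set 'I_n * 'I_n})
    (x : 'M[R]_n) (X : 'I_n * 'I_n -> {RV P >-> R}) (w : T) : 'M[R]_n :=
  \matrix_(i, j) if (i, j) \in J then X (i, j) w else x i j.

Lemma sparse_mixed_mx (R : realType) (n : nat) (d : measure_display)
    (T : measurableType d) (P : probability T R) (S : {set 'I_n * 'I_n})
    (x : 'M[R]_n) (X : 'I_n * 'I_n -> {RV P >-> R}) (w : T) :
  pattern_mx S x -> mixed_mx S x X w = sparse_mx S X w.
Proof.
by move=> Sx; apply/matrixP => i j; rewrite !mxE; case: ifPn => // /Sx.
Qed.

Lemma mixed_mx_entry (R : realType) (n : nat) (d : measure_display)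
    (T : measurableType d) (P : probability T R) (J : {set 'I_n * 'I_n})
    (x : 'M[R]_n) (X : 'I_n * 'I_n -> {RV P >-> R}) i j :
  (fun w => mixed_mx J x X w i j) =
  if (i, j) \in J then X (i, j) : T -> R else cst (x i j).
Proof. by apply/funext => w; rewrite mxE; case: ifP. Qed.

Lemma mixed_mx_measurable (R : realType) (n : nat) (d : measure_display)
    (T : measurableType d) (P : probability T R) (J : {set 'I_n * 'I_n})
    (x : 'M[R]_n) (X : 'I_n * 'I_n -> {RV P >-> R}) i j :
  measurable_fun setT (fun w => mixed_mx J x X w i j).
Proof. by rewrite mixed_mx_entry; case: ifP. Qed.

Lemma mixed_mx_cylinders (R : realType) (n : nat) (d : measure_display)
    (T : measurableType d) (P : probability T R) (J S : {set 'I_n * 'I_n})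
    (x : 'M[R]_n) (X : 'I_n * 'I_n -> {RV P >-> R}) p i j :
  J \subset S -> (i, j) != p ->
  measurable_fun setT
    ((fun w => mixed_mx J x X w i j) :
      g_sigma_algebraType (cylinders (S :\ p) X) -> R).
Proof.
move=> JS ijp; apply: (eq_measurable_fun ((if (i, j) \in J then X (i, j) : T -> R
    else cst (x i j)) : g_sigma_algebraType (cylinders (S :\ p) X) -> R)).
  by move=> w _; rewrite -mixed_mx_entry.
case: ifP => ijJ //; apply: measurable_cylinders_RV.
by rewrite !inE ijp (fintype.subsetP JS).
Qed.

(** The event implies t |a - z| <= |a|, where the root z depends only on the entries other than the
    Gaussian a; [normal_prob_ratio] bounds each section. *)
Lemma entry_ratio_tail (R : realType) (n : nat) (d : measure_display)
    (T : measurableType d) (P : probability T R) (S : {set 'I_n * 'I_n})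
    (X : 'I_n * 'I_n -> {RV P >-> R}) (F : 'M[R]_n -> R) (p : 'I_n * 'I_n)
    (t : R) :
  mutually_independent S X -> p \in S -> standard_gaussian (X p) ->
  entry_affine F -> entry_measurable F -> 2 <= t ->
  (P [set w | (t <= entry_ratio F p (sparse_mx S X w))%R] <= (t^-1)%:E)%E.
Proof.
move=> Xindep pS Xg affF mF t2.
have t0 : 0 < t by lra.
have mfst : measurable_fun setT (fst : R * R -> R) by exact: measurable_fst.
have msnd : measurable_fun setT (snd : R * R -> R) by exact: measurable_snd.
pose E : set (R * R) := [set u | t * `|u.2 - u.1| <= `|u.2|].
have mE : measurable E.
  apply: measurable_le_set; last exact: measurableT_comp.
  apply: measurable_funM => //; apply: measurableT_comp => //.
  exact: measurable_funB.
pose H w := affine_root F p (mixed_mx S 0 X w).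
have mH : measurable_fun setT
    (H : g_sigma_algebraType (cylinders (S :\ p) X) -> R).
  apply: affine_root_measurable => // i j ijp.
  exact: mixed_mx_cylinders.
have HE := @independent_product _ _ _ P _ S X p H E t^-1 Xindep pS Xg mH mE.
have sparseE w : sparse_mx S X w = mixed_mx S 0 X w.
  by rewrite sparse_mixed_mx// => i j _; rewrite mxE.
apply: le_trans (HE _); last by move=> y; exact: normal_prob_ratio.
apply: le_measure; rewrite ?inE.
- apply: measurable_le_set => //; under eq_fun do rewrite sparseE.
  by apply: entry_ratio_measurable => // i j; exact: mixed_mx_measurable.
- have mHT : measurable_fun setT H.
    by apply: affine_root_measurable => // i j _; exact: mixed_mx_measurable.
  rewrite -[X in measurable X]setTI.
  by apply: (measurable_fun_pair mHT (measurable_funPT (X p))).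
- move=> w /= /(entry_ratio_ge affF t0).
  by rewrite /E /= /H sparseE; case: (p) pS => i j ijS; rewrite !mxE /= ijS.
Qed.

(** Induction on the number of Gaussian entries. When entry [p] becomes Gaussian, a zero of [F] is
    either already a zero before the replacement, or [X p] hits a root independent of it, which has
    probability 0 since the Gaussian law has no atoms. *)
Lemma mixed_mx_nonzero (R : realType) (n : nat) (d : measure_display)
    (T : measurableType d) (P : probability T R) (S : {set 'I_n * 'I_n})
    (X : 'I_n * 'I_n -> {RV P >-> R}) (F : 'M[R]_n -> R) (x : 'M[R]_n) :
  mutually_independent S X -> (forall p, p \in S -> standard_gaussian (X p)) ->
  entry_affine F -> entry_measurable F -> F x != 0 ->
  forall J : {set 'I_n * 'I_n}, J \subset S ->
  P [set w | F (mixed_mx J x X w) = 0%R] = 0%E.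
Proof.
move=> Xindep Xg affF mF Fx0 J; move Dk: #|J| => k.
elim: k J Dk => [|k IH] J Jk JS.
  rewrite (_ : [set w | _] = set0) ?measure0//; apply/seteqP; split => // w /=.
  move/eqP: Jk; rewrite cards_eq0 => /eqP ->.
  rewrite (_ : mixed_mx _ _ _ _ = x); first by move/eqP; rewrite (negbTE Fx0).
  by apply/matrixP => i j; rewrite mxE inE.
have [p pJ] : exists p, p \in J by apply/set0Pn; rewrite -card_gt0 Jk.
have pS : p \in S by exact: (fintype.subsetP JS).
pose J' := J :\ p.
have J'S : J' \subset S by apply: fintype.subset_trans JS; exact: subD1set.
have J'k : #|J'| = k by move: Jk; rewrite (cardsD1 p) pJ => -[].
pose N w := mixed_mx J' x X w; pose H w := affine_root F p (N w).
have mfst : measurable_fun setT (fst : R * R -> R) by exact: measurable_fst.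
have msnd : measurable_fun setT (snd : R * R -> R) by exact: measurable_snd.
have mE : measurable [set u : R * R | u.2 = u.1] by exact: measurable_eq_set.
have mH : measurable_fun setT
    (H : g_sigma_algebraType (cylinders (S :\ p) X) -> R).
  by apply: affine_root_measurable => // i j ijp; exact: mixed_mx_cylinders.
have HT : measurable_fun setT H.
  by apply: affine_root_measurable => // i j _; exact: mixed_mx_measurable.
have PH : (P [set w | X p w = H w] <= 0%:E)%E.
  apply: (independent_product Xindep pS (Xg _ pS) mH mE) => y /=.
  by rewrite (_ : [set a | a = y] = [set y])// normal_prob_set1.
have mFN (L : {set 'I_n * 'I_n}) : measurable [set w | F (mixed_mx L x X w) = 0].
  apply: measurable_eq_set => //; apply: mF => i j.
  exact: mixed_mx_measurable.
apply/eqP; rewrite -measure_le0.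
have mXH : measurable [set w | X p w = H w] by exact: measurable_eq_set.
apply: (@le_trans _ _ (P ([set w | F (N w) = 0] `|` [set w | X p w = H w]))).
  apply: le_measure; rewrite ?inE//.
    by apply: measurableU => //; exact: mFN.
  move=> w /=; have -> : mixed_mx J x X w = set_entry (N w) p (X p w).
    apply/matrixP => i j; rewrite !mxE !inE; case: eqVneq => //= ->.
    by rewrite pJ.
  (* With zero slope, [F] does not see entry [p], so it already vanishes at [N w]. *)
  have [C0|C0] := eqVneq (affine_slope F p (N w)) 0.
    have E h : F (set_entry (N w) p h) = F (set_entry (N w) p 0).
      by rewrite affF -/(affine_slope F p _) C0 mulr0 addr0.
    by rewrite E -(E (N w p.1 p.2)) set_entry_id; left.
  rewrite affine_rootE// => /eqP; rewrite mulf_eq0 (negbTE C0)/= subr_eq0.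
  by move=> /eqP; right.
have PN : P [set w | F (N w) = 0%R] = 0%E := IH _ J'k J'S.
apply: (@le_trans _ _ (P [set w | F (N w) = 0%R] + P [set w | X p w = H w])%E).
  by apply: measureU2 => //; exact: mFN.
by rewrite PN add0e.
Qed.

(** * Expectation of the logarithm *)

Definition ln_plus (R : realType) (x : R) : R := ln (Num.max 1 x).

Lemma ln_plus_ge0 (R : realType) (x : R) : 0 <= ln_plus x.
Proof. by rewrite /ln_plus ln_ge0// le_max lexx. Qed.

Lemma ln_plusM (R : realType) (a x : R) : 1 <= a ->
  ln_plus (a * x) <= ln a + ln_plus x.
Proof.
move=> a1; have a0 : 0 < a by exact: lt_le_trans a1.
have m0 : 0 < Num.max 1 x by rewrite lt_max ltr01.
rewrite /ln_plus -lnM ?posrE// ler_ln ?posrE ?mulr_gt0//; last first.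
  by rewrite lt_max ltr01.
rewrite ge_max; apply/andP; split.
  by rewrite -[X in X <= _]mulr1 ler_pM// le_max lexx.
by rewrite ler_pM2l// le_max lexx orbT.
Qed.

Lemma ln_plus_measurable (R : realType) (d : measure_display)
    (T : measurableType d) (V : T -> R) :
  measurable_fun setT V -> measurable_fun setT (fun w => ln_plus (V w)).
Proof.
move=> mV; apply: (measurableT_comp (@measurable_ln R)).
exact: measurable_maxr.
Qed.

Lemma integral_expRN (R : realType) :
  (\int[lebesgue_measure]_(s in `[0%R, +oo[) (expR (- s))%:E = 1%:E :> \bar R)%E.
Proof.
have := @integral_exponential_pdf R 1%R ltr01.
rewrite /exponential_pdf => <-.
rewrite [LHS]integral_mkcond; apply: eq_integral => x _.
rewrite /patch; case: ifP => // _.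
by rewrite mul1r mulN1r.
Qed.

(** ln_+ V <= ln K + ln_+ (V / K), and the last term exceeds s >= 0 only if V > K exp s, an event of
    probability at most exp (- s). Integrating over s gives the 1. *)
Lemma expectation_ln_plus (R : realType) (d : measure_display)
    (T : measurableType d) (P : probability T R) (V : T -> R) (K : R) :
  measurable_fun setT V -> 1 <= K ->
  (forall t, K <= t -> (P [set w | (t <= V w)%R] <= (K / t)%:E)%E) ->
  (\int[P]_w (ln_plus (V w))%:E <= (ln K + 1)%:E)%E.
Proof.
move=> mV K1 tail; have K0 : 0 < K by exact: lt_le_trans K1.
have mW : measurable_fun setT (fun w => ln_plus (K^-1 * V w)).
  by apply: ln_plus_measurable; exact: measurable_funM.
pose W : {RV P >-> R} := HB.pack (fun w => ln_plus (K^-1 * V w))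
  (isMeasurableFun.Build _ _ _ _ _ mW).
have W_le1 : (\int[P]_w (ln_plus (K^-1 * V w))%:E <= 1%:E)%E.
  have := @ge0_expectation_ccdf _ _ _ P W (fun w => ln_plus_ge0 _).
  rewrite unlock => ->; rewrite -integral_expRN.
  apply: ge0_le_integral => //=.
  - by apply: measurable_funTS; exact: ccdf_measurable.
  - apply/measurable_EFinP; apply: measurable_funTS.
    by apply: measurableT_comp; [exact: measurable_expR|exact: measurable_funN].
  move=> s; rewrite in_itv/= andbT => s0.
  have es1 : 1 <= expR s by rewrite -expR0 ler_expR.
  have Ks : K <= K * expR s by rewrite ler_peMr// ltW.
  have -> : expR (- s) = K / (K * expR s).
    by rewrite expRN invfM mulrA divff ?mul1r// gt_eqF.
  apply: le_trans (tail _ Ks); rewrite /ccdf /distribution /pushforward.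
  apply: le_measure; rewrite ?inE.
  - by apply: measurable_preimage_RV.
  - exact: measurable_le_set.
  move=> w /=; rewrite in_itv/= andbT /ln_plus => sW.
  have : expR s < Num.max 1 (K^-1 * V w).
    by rewrite -ltr_ln ?posrE ?expR_gt0 ?expRK// lt_max ltr01.
  rewrite lt_max ltNge es1/= => /ltW.
  by rewrite -(ler_pM2l K0) mulrA divff ?mul1r// gt_eqF.
have -> : (ln K + 1)%:E = (\int[P]_w (ln K)%:E + 1%:E)%E.
  by rewrite integral_cst//= probability_setT mule1.
apply: (@le_trans _ _ (\int[P]_w ((ln K)%:E + (ln_plus (K^-1 * V w))%:E))%E).
  apply: ge0_le_integral => //.
  - by move=> w _; rewrite lee_fin ln_plus_ge0.
  - by apply/measurable_EFinP; exact: ln_plus_measurable.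
  - by apply/measurable_EFinP; exact: measurable_funD.
  move=> w _; rewrite -EFinD lee_fin.
  have {1}-> : V w = K * (K^-1 * V w) by rewrite mulrA divff ?mul1r// gt_eqF.
  exact: ln_plusM.
rewrite ge0_integralD//=.
- by rewrite leeD2l.
- by move=> w _; rewrite lee_fin ln_ge0.
- by move=> w _; rewrite lee_fin ln_plus_ge0.
- exact/measurable_EFinP.
Qed.

(** The integral of [f] is a supremum over simple functions below [f], each of them almost
    everywhere below [g]. This spares a proof that [cond_inv] of the random matrix is measurable. *)
Lemma ae_le_integral_nonmeasurable (R : realType) (d : measure_display)
    (T : measurableType d) (mu : {measure set T -> \bar R}) (f g : T -> \bar R) :
  (forall x, 0 <= f x)%E -> (forall x, 0 <= g x)%E -> measurable_fun setT g ->
  {ae mu, forall x, (f x <= g x)%E} ->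
  (\int[mu]_x f x <= \int[mu]_x g x)%E.
Proof.
move=> f0 g0 mg fg; rewrite ge0_integralTE//; apply: ub_ereal_sup => _ [h hf <-].
rewrite -integralT_nnsfun; apply: ae_ge0_le_integral => //.
- by move=> x _; rewrite lee_fin.
- exact/measurable_EFinP.
- by apply: filterS fg => x fgx _; exact: le_trans (hf x) fgx.
Qed.

Lemma bigmax_measurable (R : realType) (d : measure_display)
    (T : measurableType d) (I : Type) (s : seq I) (h : I -> T -> R) :
  (forall i, measurable_fun setT (h i)) ->
  measurable_fun setT (fun w => \big[Num.max/0]_(i <- s) h i w).
Proof.
move=> mh; elim: s => [|i s IH]; first by
  under eq_fun do rewrite big_nil; exact: measurable_cst.
under eq_fun do rewrite big_cons.
exact: measurable_maxr.
Qed.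

(** A union bound; [0 < t] keeps the initial value 0 of the maximum out of the event. *)
Lemma bigmax_tail (R : realType) (d : measure_display)
    (T : measurableType d) (P : probability T R) (I : eqType) (s : seq I)
    (h : I -> T -> R) (t c : R) :
  0 < t -> (forall i, measurable_fun setT (h i)) ->
  (forall i, i \in s -> (P [set w | (t <= h i w)%R] <= c%:E)%E) ->
  (P [set w | (t <= \big[Num.max/0]_(i <- s) h i w)%R] <=
    ((size s)%:R * c)%:E)%E.
Proof.
move=> t0 mh; elim: s => [|i s IH] hc.
  rewrite mul0r (_ : [set w | _] = set0) ?measure0//.
  by apply/seteqP; split => // w /=; rewrite big_nil leNgt t0.
rewrite /= -natr1 addrC mulrDl mul1r EFinD.
have mset j : measurable [set w | t <= h j w] by exact: measurable_le_set.
have mmax : measurable [set w | t <= \big[Num.max/0]_(i <- s) h i w].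
  by apply: measurable_le_set => //; exact: bigmax_measurable.
rewrite (_ : [set w | _] = [set w | t <= h i w] `|`
    [set w | t <= \big[Num.max/0]_(i <- s) h i w]).
  apply: le_trans (measureU2 _ (mset i) mmax) _; apply: leeD.
    by apply: hc; rewrite mem_head.
  by apply: IH => j js; apply: hc; rewrite inE js orbT.
apply/seteqP; split => w /=; rewrite big_cons le_max; first by move=> /orP.
by move=> /orP.
Qed.

Lemma logb_plus_le (R : realType) (b : R) (x : \bar R) (r : R) :
  1 < b -> (x <= r%:E)%E -> (logb_plus b x <= (ln_plus r / ln b)%:E)%E.
Proof.
move=> b1 xr; have lb : 0 < ln b by exact: ln_gt0.
have r0 : (0%:E <= (ln_plus r / ln b)%:E)%E.
  by rewrite lee_fin divr_ge0 ?ln_plus_ge0 ?ltW.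
case: x xr => [x||]//; rewrite lee_fin /= => xr; case: ifP => // x1.
rewrite lee_fin /logb ler_pM2r ?invr_gt0// /ln_plus.
by rewrite ler_ln ?posrE ?(lt_le_trans ltr01 x1) ?lt_max ?ltr01// le_max xr orbT.
Qed.

Lemma logb_plus_ge0 (R : realType) (b : R) (x : \bar R) :
  1 < b -> (0 <= logb_plus b x)%E.
Proof.
move=> b1; case: x => [x||] //=; case: ifP => // x1.
by rewrite lee_fin divr_ge0 ?ln_ge0// ltW.
Qed.

Theorem corollary2 (R : realType) (n : nat) (n_ge1 : (1 <= n)%N)
    (b : R) (b_gt1 : 1 < b)
    (S : {set 'I_n * 'I_n})
    (S_nonsing : ~ (@pattern_mx R n S `<=` @singular_mx R n))
    (d : measure_display) (T : measurableType d) (P : probability T R)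
    (X : 'I_n * 'I_n -> {RV P >-> R})
    (X_gauss : forall p, p \in S -> standard_gaussian (X p))
    (X_indep : mutually_independent S X) :
  (\int[P]_w logb_plus b (cond_inv (sparse_mx S X w)) <=
   (2 * logb b n%:R + 2 * logb b #|S|%:R + logb b 4 + 1 / ln b)%:E)%E.
Proof.
have lb : 0 < ln b by exact: ln_gt0.
have i0 : 'I_n := Ordinal n_ge1.
have [B SB uB] : exists2 B : 'M[R]_n, pattern_mx S B & B \in unitmx.
  apply: contrapT => noB; apply: S_nonsing => B SB /=.
  by apply/negP => uB; apply: noB; exists B.
(* An empty pattern would admit only the zero matrix, which is singular because [1 <= n]. *)
have S1 : 1 <= #|S|%:R :> R.
  rewrite (ler_nat _ 1) card_gt0; apply/eqP => S0.
  have B0 : B = 0.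
    by apply/matrixP => i j; rewrite mxE SB// S0 inE.
  have := mulVmx uB; rewrite B0 mulmx0 => /matrixP/(_ i0 i0).
  by rewrite !mxE eqxx => /eqP; rewrite eq_sym oner_eq0.
pose M := sparse_mx S X.
(* One index type for all polynomials. The determinant is repeated for each pair of indices, which
   makes the count 2 n^2, the constant of the union bound. *)
pose F (q : 'I_n * 'I_n * bool) (A : 'M[R]_n) :=
  if q.2 then \det A else (\adj A) q.1.1 q.1.2.
have affF q : entry_affine (F q).
  by rewrite /F; case: q.2; [exact: det_affine|exact: adj_affine].
have mF q : entry_measurable (F q).
  by rewrite /F; case: q.2; [exact: det_measurable|exact: adj_measurable].
have mM i j : measurable_fun setT (fun w => M w i j).
  have E w : M w = mixed_mx S 0 X w.
    by rewrite sparse_mixed_mx// => u v _; rewrite mxE.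
  by under eq_fun do rewrite E; exact: mixed_mx_measurable.
pose s := [seq (p, q) | p <- enum S, q <- enum {: 'I_n * 'I_n * bool}].
pose h (u : ('I_n * 'I_n) * ('I_n * 'I_n * bool)) w :=
  entry_ratio (F u.2) u.1 (M w).
pose V w := \big[Num.max/0]_(u <- s) h u w.
have mh u : measurable_fun setT (h u) by exact: entry_ratio_measurable.
have mV : measurable_fun setT V by exact: bigmax_measurable.
have size_s : (size s)%:R = 2 * n%:R ^+ 2 * #|S|%:R :> R.
  rewrite size_allpairs -!cardE !card_prod card_bool card_ord !natrM.
  by rewrite cardE; ring.
have n1 : 1 <= n%:R :> R by rewrite (ler_nat _ 1).
(* Every t from [size s] on is thus in the range [2 <= t] of the tail bound. *)
have s2 : 2 <= (size s)%:R :> R by rewrite size_s expr2; nra.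
have tailV t : (size s)%:R <= t ->
    (P [set w | (t <= V w)%R] <= ((size s)%:R / t)%:E)%E.
  move=> st; have t2 : 2 <= t by exact: le_trans st.
  apply: bigmax_tail => //; first by lra.
  move=> _ /allpairsP[[p q] /= [pS _ ->]]; rewrite mem_enum in pS.
  by apply: entry_ratio_tail => //; exact: X_gauss.
have s1 : 1 <= (size s)%:R :> R by lra.
have intV := expectation_ln_plus mV s1 tailV.
have nonzero (q : 'I_n * 'I_n * bool) (C : 'M[R]_n) :
    pattern_mx S C -> F q C != 0 ->
    {ae P, forall w, F q (M w) != 0}.
  move=> SC FC; exists [set w | F q (M w) = 0]; split.
  - apply: measurable_eq_set => //; exact: mF.
  - rewrite -(mixed_mx_nonzero X_indep X_gauss (affF q) (mF q) FC (subxx _)).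
    by congr (P _); apply/seteqP; split => w /=; rewrite sparse_mixed_mx.
  - by move=> w /= /negP; rewrite negbK => /eqP.
have ae_adj : {ae P, forall w, forall kl : 'I_n * 'I_n,
    (\adj (M w)) kl.1 kl.2 != 0 \/
    forall B : 'M[R]_n, pattern_mx S B -> (\adj B) kl.1 kl.2 = 0}.
  apply: filter_forall => kl.
  have [Z|/existsNP[C /not_implyP[SC /eqP C0]]] :=
    pselect (forall B : 'M[R]_n, pattern_mx S B -> (\adj B) kl.1 kl.2 = 0).
    by apply: nearW => w; right.
  by apply: filterS (nonzero (kl, false) C SC C0) => w; left.
have ae_det : {ae P, forall w, M w \in unitmx}.
  have dB : \det B != 0 by move: uB; rewrite unitmxE unitfE.
  apply: filterS (nonzero (i0, i0, true) B SB dB) => w.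
  by rewrite unitmxE unitfE.
have ae_le : {ae P, forall w, (logb_plus b (cond_inv (M w)) <=
    ((ln (2 * #|S|%:R) + ln_plus (V w)) / ln b)%:E)%E}.
  apply: filterS2 ae_det ae_adj => w uM adjM.
  have hV p q : p \in S -> entry_ratio (F q) p (M w) <= V w.
    move=> pS; apply: (le_bigmax_seq 0 (p, q) xpredT (fun u => h u w)) => //.
    by apply/allpairsP; exists (p, q); split => //; rewrite mem_enum.
  have V0 : 0 <= V w by exact: bigmax_ge_id.
  have patM : pattern_mx S (M w) by move=> i j ijS; rewrite mxE (negbTE ijS).
  have cV : (cond_inv (M w) <= (2 * #|S|%:R * V w)%:E)%E.
    apply: (cond_inv_le uM patM V0) => [k l|p pS|p k l pS].
    - exact: (adjM (k, l)).
    - exact: (hV p (i0, i0, true)).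
    - exact: (hV p (k, l, false)).
  apply: le_trans (logb_plus_le b_gt1 cV) _.
  by rewrite lee_fin ler_pM2r ?invr_gt0// ln_plusM//; lra.
apply: le_trans (ae_le_integral_nonmeasurable _ _ _ ae_le) _.
- by move=> w; exact: logb_plus_ge0.
- move=> w; rewrite lee_fin divr_ge0 ?addr_ge0 ?ln_plus_ge0 ?ln_ge0 ?ltW//; lra.
- apply/measurable_EFinP; apply: measurable_funM => //.
  by apply: measurable_funD => //; exact: ln_plus_measurable.
under eq_integral do rewrite mulrDl EFinD [X in (_ + X)%E]EFinM muleC.
have mlnV : measurable_fun setT (fun w => (ln_plus (V w))%:E).
  by apply/measurable_EFinP; exact: ln_plus_measurable.
rewrite ge0_integralD//=.
- rewrite integral_cst//= probability_setT mule1 ge0_integralZl//.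
  + apply: le_trans (leeD2l _ (lee_wpmul2l _ intV)) _.
      by rewrite lee_fin invr_ge0 ltW.
    rewrite -EFinM -EFinD lee_fin /logb size_s.
    have n0 : 0 < n%:R :> R by lra.
    have S0 : 0 < #|S|%:R :> R by lra.
    (* What remains is ln (2 |S|) + ln (2 n^2 |S|) + 1 = 2 ln n + 2 ln |S| + ln 4 + 1, divided by
       [ln b]. *)
    have -> : 4 = 2 * 2 :> R by ring.
    rewrite !lnM ?posrE ?exprn_gt0 ?mulr_gt0//.
    by rewrite le_eqVlt; apply/orP; left; apply/eqP; field; rewrite gt_eqF.
  + by move=> w _; rewrite lee_fin ln_plus_ge0.
  + by rewrite lee_fin invr_ge0 ltW.
- by move=> w _; rewrite lee_fin divr_ge0 ?ln_ge0 ?ltW//; lra.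
- by move=> w _; rewrite lee_fin mulr_ge0 ?invr_ge0 ?ln_plus_ge0// ltW.
- exact: measurable_funeM.
Qed.
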